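(* Let $N\ge 2$, let $\Gamma\subset SL(2,\mathbb{C})$ be a finite subgroup, and let $W$ be an irreducible complex $S_N$-module. If $W$ extends to a representation of $H_{1,k,c}(\mathbf{\Gamma}_N)$ for some $(k,c)$ with $k\ne 0$ (i.e. the action of $\mathbb{C}[S_N]\subset H_{1,k,c}(\mathbf{\Gamma}_N)$ on the vector space $W$ extends to an action of the whole algebra), then the Young diagram of $W$ is a rectangle.
   Context: Let $L=\mathbb{C}^2$ with its standard symplectic form $\omega_L$, and $V=L^{\oplus N}$ with $\omega_V=\omega_L^{\oplus N}$. The group $\mathbf{\Gamma}_N=S_N\ltimes\Gamma^N$ acts on $V$ ($S_N$ permutes the summands, the $i$-th factor $\Gamma$ acts on the $i$-th summand). For $\gamma\in\Gamma$, $\gamma_i$ denotes $\gamma$ placed in the $i$-th factor; $s_{ij}$ is the transposition $(ij)$. The set $\mathcal{S}$ of symplectic reflections ($s\in\mathbf{\Gamma}_N$ with $\mathrm{rk}(\mathrm{Id}-s)|_V=2$) consists of (S) the elements $s_{ij}\gamma_i\gamma_j^{-1}$ ($i\ne j$, $\gamma\in\Gamma$), forming one conjugacy class, and ($\Gamma$) the elements $\gamma_i$, $\gamma\in\Gamma\setminus\{1\}$. Conjugation invariant functions $\mathcal{S}\to\mathbb{C}$ are written as pairs $(k,c)$, where $k\in\mathbb{C}$ is the value on elements of type (S) and $c$ is a conjugation invariant function on $\Gamma\setminus\{1\}$, $c_\gamma$ being the value on $\gamma_i$. For $s\in\mathcal{S}$, $\omega_s$ is the bilinear form on $V$ which coincides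 with $\omega_V$ on $\mathrm{Im}(\mathrm{Id}-s)$ and has radical $\mathrm{Ker}(\mathrm{Id}-s)$. $H_{1,k,c}(\mathbf{\Gamma}_N)$ is the quotient of the smash product $\mathbf{\Gamma}_N\sharp TV$ ($TV$ the tensor algebra) by the two-sided ideal generated by $[u,v]-\omega_V(u,v)\cdot 1-\sum_{s\in\mathcal{S}}f_s\,\omega_s(u,v)\,s$, $u,v\in V$, where $f_s$ is the value of $(k,c)$ at $s$. *)

(* Defs.v *)
From HB Require Import structures.
From mathcomp Require Import all_boot all_order all_algebra all_fingroup.
From mathcomp Require Import all_character generic_quotient ring_quotient.
From mathcomp Require Import boolp reals complex monalg.

Set Implicit Arguments.
Unset Strict Implicit.
Unset Printing Implicit Defensive.

Import GRing.Theory.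
Local Open Scope ring_scope.
Local Open Scope quotient_scope.

(* -------------------------------------------------------------------- *)
(* The wreath product S_N |>< Gamma^N.  The pair (s, a) stands for the    *)
(* product a s; it acts on V by (a s v)_i = a_i v_(s i).  As permutations *)
(* multiply from left to right in MathComp ((s * t) i = t (s i)), this    *)
(* is a left action.                                                      *)

Definition wreath (gT : finGroupType) (N : nat) : Type :=
  ('S_N * {ffun 'I_N -> gT})%type.

HB.instance Definition _ gT N := Finite.on (wreath gT N).

Section WreathGroup.
Variables (gT : finGroupType) (N : nat).
Implicit Types g h : wreath gT N.

Definition wreath_one : wreath gT N := (1%g, [ffun=> 1%g]).
Definition wreath_mul g h : wreath gT N :=
  ((g.1 * h.1)%g, [ffun i => (g.2 i * h.2 (g.1 i))%g]).
Definition wreath_inv g : wreath gT N :=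
  ((g.1)^-1%g, [ffun i => ((g.2 ((g.1)^-1%g i))^-1)%g]).

Lemma wreath_mulA : associative wreath_mul.
Proof.
move=> g h k; congr pair => /=; first by rewrite mulgA.
by apply/ffunP=> i; rewrite !ffunE /= permM mulgA.
Qed.

Lemma wreath_mul1 : left_id wreath_one wreath_mul.
Proof.
case=> s a; congr pair => /=; first by rewrite mul1g.
by apply/ffunP=> i; rewrite !ffunE /= perm1 mul1g.
Qed.

Lemma wreath_mulV : left_inverse wreath_one wreath_inv wreath_mul.
Proof.
case=> s a; congr pair => /=; first by rewrite mulVg.
by apply/ffunP=> i; rewrite !ffunE /= mulVg.
Qed.

HB.instance Definition _ :=
  Finite_isGroup.Build (wreath gT N) wreath_mulA wreath_mul1 wreath_mulV.

Definition wreath_perm (s : 'S_N) : wreath gT N := (s, [ffun=> 1%g]).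
Definition wreath_base (i : 'I_N) (x : gT) : wreath gT N :=
  (1%g, [ffun j => if j == i then x else 1%g]).

End WreathGroup.

(* -------------------------------------------------------------------- *)
(* Smash product G # A of a finite group with an algebra on which it acts *)
(* by algebra automorphisms: f stands for the sum over g of (f g) g, and  *)
(* g a = (g a g^-1) g with g a g^-1 = alg_act g a.                        *)

Record alg_action (K : comNzRingType) (G : finGroupType) (A : lalgType K) :=
  AlgAction {
    alg_act :> G -> {lrmorphism A -> A};
    alg_act1 : forall a, alg_act 1%g a = a;
    alg_actM : forall g h a, alg_act (g * h)%g a = alg_act g (alg_act h a)
  }.

Definition smash (K : comNzRingType) (G : finGroupType) (A : lalgType K)
  (to : alg_action G A) : Type := {ffun G -> A}.

Section Smash.
Variables (K : comNzRingType) (G : finGroupType) (A : lalgType K).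
Variable to : alg_action G A.
Local Notation S := (smash to).

HB.instance Definition _ := GRing.Lmodule.on S.

Definition smash_term (a : A) (g : G) : S :=
  [ffun h => if h == g then a else 0].
Definition smash_alg (a : A) : S := smash_term a 1%g.
Definition smash_grp (g : G) : S := smash_term 1 g.

Definition smash_one : S := smash_term 1 1%g.
Definition smash_mul (f1 f2 : S) : S :=
  [ffun g => \sum_h f1 h * to h (f2 (h^-1 * g)%g)].

Lemma smash_mulA : associative smash_mul.
Proof.
move=> f1 f2 f3; apply/ffunP=> g; rewrite !ffunE.
under eq_bigr => h _ do rewrite ffunE rmorph_sum mulr_sumr.
under [RHS]eq_bigr => h _ do rewrite ffunE mulr_suml.
rewrite [RHS]exchange_big /=; apply: eq_bigr => h _.
rewrite [RHS](reindex_inj (mulgI h)) /=; apply: eq_bigr => k _.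
by rewrite mulKg rmorphM alg_actM mulrA invMg mulgA.
Qed.

Lemma smash_mul1l : left_id smash_one smash_mul.
Proof.
move=> f; apply/ffunP=> g; rewrite ffunE (bigD1 1%g) //= big1 => [|h /negPf h1].
  by rewrite ffunE eqxx mul1r alg_act1 invg1 mul1g addr0.
by rewrite ffunE h1 mul0r.
Qed.

Lemma smash_mul1r : right_id smash_one smash_mul.
Proof.
move=> f; apply/ffunP=> g; rewrite ffunE (bigD1 g) //= big1 => [|h hg].
  by rewrite ffunE mulVg eqxx rmorph1 mulr1 addr0.
by rewrite ffunE -eq_mulVg1 (negPf hg) rmorph0 mulr0.
Qed.

Lemma smash_mulDl : left_distributive smash_mul +%R.
Proof.
move=> f1 f2 f3; apply/ffunP=> g; rewrite !ffunE -big_split.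
by apply: eq_bigr => h _; rewrite ffunE mulrDl.
Qed.

Lemma smash_mulDr : right_distributive smash_mul +%R.
Proof.
move=> f1 f2 f3; apply/ffunP=> g; rewrite !ffunE -big_split.
by apply: eq_bigr => h _; rewrite ffunE rmorphD mulrDr.
Qed.

Lemma smash_one_neq0 : smash_one != 0.
Proof.
apply/eqP=> /ffunP/(_ 1%g); rewrite !ffunE eqxx; exact/eqP/oner_neq0.
Qed.

HB.instance Definition _ := GRing.Zmodule_isNzRing.Build S
  smash_mulA smash_mul1l smash_mul1r smash_mulDl smash_mulDr smash_one_neq0.

Lemma smash_scaleAl (c : K) (f1 f2 : S) : c *: (f1 * f2) = (c *: f1) * f2.
Proof.
apply/ffunP=> g; rewrite !ffunE scaler_sumr.
by apply: eq_bigr => h _; rewrite ffunE scalerAl.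
Qed.

HB.instance Definition _ := GRing.Lmodule_isLalgebra.Build K S smash_scaleAl.

Lemma smash_termM a b g h :
  smash_term a g * smash_term b h = smash_term (a * to g b) (g * h)%g.
Proof.
rewrite -[LHS]/(smash_mul _ _); apply/ffunP=> x; rewrite /smash_mul [LHS]ffunE.
rewrite (bigD1 g) //= big1 => [|y /negPf yg]; last by rewrite ffunE yg mul0r.
rewrite !ffunE eqxx addr0 -(inj_eq (mulgI g)) mulKVg.
by case: ifP => _; rewrite ?rmorph0 ?mulr0.
Qed.

End Smash.

(* -------------------------------------------------------------------- *)
(* Quotient of an algebra by the two-sided ideal generated by a set of    *)
(* relators.  As lalgType assumes 1 != 0, which may fail in a quotient,   *)
(* the structures are pzRingType and lmodType.                            *)

Section QuotientAlgebra.
Variables (K : comNzRingType) (A : lalgType K) (X : A -> Prop).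

Inductive ideal_gen : A -> Prop :=
| ideal_gen_relator a : X a -> ideal_gen a
| ideal_gen0 : ideal_gen 0
| ideal_genD a b : ideal_gen a -> ideal_gen b -> ideal_gen (a + b)
| ideal_genMl c a : ideal_gen a -> ideal_gen (c * a)
| ideal_genMr a c : ideal_gen a -> ideal_gen (a * c).

Definition ideal_pred : {pred A} := fun a => `[< ideal_gen a >].

Lemma ideal_predP a : reflect (ideal_gen a) (a \in ideal_pred).
Proof. exact: asboolP. Qed.

Lemma ideal_pred_zmod_closed : zmod_closed ideal_pred.
Proof.
split=> [|a b /ideal_predP Ia /ideal_predP Ib]; apply/ideal_predP.
  exact: ideal_gen0.
by apply: ideal_genD => //; rewrite -mulN1r; apply: ideal_genMl.
Qed.

HB.instance Definition _ :=
  GRing.isZmodClosed.Build A ideal_pred ideal_pred_zmod_closed.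

Definition quot_alg : Type := {ideal_quot (ideal_pred : zmodClosed A)}.

HB.instance Definition _ := GRing.Zmodule.on quot_alg.
HB.instance Definition _ := ZmodQuotient.on quot_alg.

Definition quot_proj (a : A) : quot_alg := \pi_quot_alg a.

Lemma quot_projP a b : quot_proj a = quot_proj b <-> ideal_gen (a - b).
Proof.
rewrite /quot_proj; split.
  by move/eqP; rewrite -Quotient.idealrBE => /ideal_predP.
by move=> H; apply/eqP; rewrite -Quotient.idealrBE; apply/ideal_predP.
Qed.

Definition quot_one : quot_alg := quot_proj 1.
Definition quot_mul (x y : quot_alg) : quot_alg :=
  quot_proj (repr x * repr y).
Definition quot_scale (c : K) (x : quot_alg) : quot_alg :=
  quot_proj (c *: repr x).

Lemma quot_projK (x : quot_alg) : quot_proj (repr x) = x.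
Proof. exact: reprK. Qed.

Lemma quot_repr a : ideal_gen (repr (quot_proj a) - a).
Proof. by apply/quot_projP; rewrite quot_projK. Qed.

Lemma quot_projD a b : quot_proj (a + b) = quot_proj a + quot_proj b.
Proof. by rewrite /quot_proj !piE. Qed.

Lemma quot_projM a b : quot_proj (a * b) = quot_mul (quot_proj a) (quot_proj b).
Proof.
apply/esym/quot_projP; set a' := repr _; set b' := repr _.
have -> : a' * b' - a * b = (a' - a) * b' + a * (b' - b).
  by rewrite mulrBl mulrBr addrA subrK.
by apply: ideal_genD; [apply: ideal_genMr | apply: ideal_genMl];
  apply: quot_repr.
Qed.

Lemma quot_projZ c a : quot_proj (c *: a) = quot_scale c (quot_proj a).
Proof.
apply/esym/quot_projP; rewrite -scalerBr -[_ - _]mul1r scalerAl.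
exact/ideal_genMl/quot_repr.
Qed.

Lemma quot_projS (x : quot_alg) : exists a, x = quot_proj a.
Proof. by exists (repr x); rewrite quot_projK. Qed.

Lemma quot_mulA : associative quot_mul.
Proof.
move=> x y z; have [[[a ->] [b ->]] [c ->]] :=
  (quot_projS x, quot_projS y, quot_projS z).
by rewrite -!quot_projM mulrA.
Qed.

Lemma quot_mul1l : left_id quot_one quot_mul.
Proof. by move=> x; have [a ->] := quot_projS x; rewrite -quot_projM mul1r. Qed.

Lemma quot_mul1r : right_id quot_one quot_mul.
Proof. by move=> x; have [a ->] := quot_projS x; rewrite -quot_projM mulr1. Qed.

Lemma quot_mulDl : left_distributive quot_mul +%R.
Proof.
move=> x y z; have [[[a ->] [b ->]] [c ->]] :=
  (quot_projS x, quot_projS y, quot_projS z).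
by rewrite -quot_projD -!quot_projM mulrDl quot_projD.
Qed.

Lemma quot_mulDr : right_distributive quot_mul +%R.
Proof.
move=> x y z; have [[[a ->] [b ->]] [c ->]] :=
  (quot_projS x, quot_projS y, quot_projS z).
by rewrite -quot_projD -!quot_projM mulrDr quot_projD.
Qed.

HB.instance Definition _ := GRing.Zmodule_isPzRing.Build quot_alg
  quot_mulA quot_mul1l quot_mul1r quot_mulDl quot_mulDr.

Lemma quot_scaleA c d x : quot_scale c (quot_scale d x) = quot_scale (c * d) x.
Proof. by have [a ->] := quot_projS x; rewrite -!quot_projZ scalerA. Qed.

Lemma quot_scale1 : left_id 1 quot_scale.
Proof.
by move=> x; have [a ->] := quot_projS x; rewrite -quot_projZ scale1r.
Qed.

Lemma quot_scaleDr : right_distributive quot_scale +%R.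
Proof.
move=> c x y; have [[a ->] [b ->]] := (quot_projS x, quot_projS y).
by rewrite -quot_projD -!quot_projZ scalerDr quot_projD.
Qed.

Lemma quot_scaleDl x : {morph quot_scale^~ x : c d / c + d}.
Proof.
move=> c d; have [a ->] := quot_projS x.
by rewrite -!quot_projZ scalerDl quot_projD.
Qed.

HB.instance Definition _ := GRing.Zmodule_isLmodule.Build K quot_alg
  quot_scaleA quot_scale1 quot_scaleDr quot_scaleDl.

End QuotientAlgebra.

(* -------------------------------------------------------------------- *)
(* V = L^N is the space of 2 x N matrices, the i-th column being the      *)
(* component in the i-th summand L = K^2.  Its tensor algebra is the free *)
(* algebra on the standard basis of V.                                    *)

Section SymplecticReflections.
Variables (K : fieldType) (gT : finGroupType) (N : nat).
Variable rL : mx_representation K [set: gT] 2.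
Local Notation V := 'M[K]_(2, N).
Local Notation W := (wreath gT N).
Implicit Types (g h : W) (u v : V).

Definition wreath_act g v : V :=
  \matrix_(a < 2, i < N) (rL (g.2 i) *m col (g.1 i) v) a 0.

Lemma wreath_act_is_linear g : linear (wreath_act g).
Proof.
move=> c u v; apply/matrixP=> a i; rewrite !mxE mulr_sumr -big_split.
by apply: eq_bigr => b _; rewrite !mxE mulrDr mulrCA.
Qed.

HB.instance Definition _ g :=
  GRing.isLinear.Build K V V _ (wreath_act g) (wreath_act_is_linear g).

Lemma wreath_act1 v : wreath_act 1%g v = v.
Proof.
apply/matrixP=> a i.
by rewrite !mxE (bigD1 a) //= big1 => [|b /negPf ba];
  rewrite ffunE repr_mx1 !mxE ?perm1 ?eqxx ?mul1r ?addr0 // eq_sym ba mul0r.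
Qed.

Lemma wreath_actM g h v :
  wreath_act (g * h)%g v = wreath_act g (wreath_act h v).
Proof.
apply/matrixP=> a i; rewrite [LHS]mxE ffunE repr_mxM ?in_setT // -mulmxA permM.
rewrite [RHS]mxE; congr (fun_of_matrix (_ *m _) a 0).
by apply/matrixP=> b c; rewrite ord1 [RHS]mxE [RHS]mxE.
Qed.

Definition omegaL (x y : 'cV[K]_2) : K := \det (row_mx x y).
Definition omegaV u v : K := \sum_(i < N) omegaL (col i u) (col i v).

Definition id_minus g : 'End(V) := (\1 - linfun (wreath_act g))%VF.

Definition symplectic_reflection g : bool := \dim (limg (id_minus g)) == 2.

(* V is the direct sum of Im (Id - s) and Ker (Id - s), so the form which *)
(* coincides with omegaV on the image and has the kernel as radical is    *)
(* omegaV composed with the projection onto the image along the kernel.   *)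
Definition omega_s g u v : K :=
  let p := daddv_pi (limg (id_minus g)) (lker (id_minus g)) in
  omegaV (p u) (p v).

Definition refl_S (i j : 'I_N) (x : gT) : W :=
  (wreath_perm gT (tperm i j) * wreath_base i x * (wreath_base j x)^-1)%g.

(* Only meaningful on symplectic reflections; c 1 is not used. *)
Definition refl_value (k : K) (c : gT -> K) g : K :=
  if [exists i, exists j, exists x, (i != j) && (g == refl_S i j x)] then k
  else if [pick p : 'I_N * gT | (p.2 != 1%g) && (g == wreath_base p.1 p.2)]
       is Some p then c p.2 else 0.

Local Notation word := {fmonom ('I_2 * 'I_N)%type}.
Local Notation tensV := {malg K[word]}.

Definition tens_vec v : tensV :=
  \sum_(x : 'I_2 * 'I_N) v x.1 x.2 *: << fmu x >>.

Lemma tens_vec_is_linear : linear tens_vec.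
Proof.
move=> c u v; rewrite /tens_vec scaler_sumr -big_split /=.
by apply: eq_bigr => x _; rewrite !mxE scalerDl scalerA.
Qed.

HB.instance Definition _ :=
  GRing.isLinear.Build K V tensV _ tens_vec tens_vec_is_linear.

Lemma tens_mul_alg c (t : tensV) : t * c%:A = c *: t.
Proof.
have -> : c%:A = @mkmalgU word K mone c by rewrite -mul_malgC mulr1.
rewrite [in LHS](monalgE t) [in RHS](monalgE t) mulr_suml scaler_sumr.
apply: eq_bigr => m _; rewrite -mul_malgC !malgM_def !fgmulUU.
by rewrite mulrC mulm1 mul1m.
Qed.

(* The algebra endomorphism of TV that extends the action of g on V. *)
Definition tens_act_word g (m : word) : tensV :=
  \prod_(x <- (m : seq _)) tens_vec (wreath_act g (delta_mx x.1 x.2)).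

Definition tens_act g : tensV -> tensV :=
  mmap (GRing.in_alg tensV) (tens_act_word g).

Lemma tens_act_word_is_multiplicative g : mmorphism (tens_act_word g).
Proof.
by split=> [m1 m2|]; rewrite /tens_act_word ?fmM ?big_cat // fm1 big_nil.
Qed.

HB.instance Definition _ g :=
  isMultiplicative.Build _ _ (tens_act_word g)
    (tens_act_word_is_multiplicative g).

HB.instance Definition _ g := GRing.Additive.on (tens_act g).

Lemma tens_act_is_monoid_morphism g : monoid_morphism (tens_act g).
Proof.
have [tM t1] : multiplicative (tens_act g).
  apply: commr_mmap_is_multiplicative => t m m'.
  by rewrite /GRing.comm tens_mul_alg /= mulr_algl.
by split.
Qed.

HB.instance Definition _ g :=
  GRing.isMonoidMorphism.Build tensV tensV (tens_act g)
    (tens_act_is_monoid_morphism g).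

Lemma tens_act_is_scalable g : scalable (tens_act g).
Proof. by move=> c t; rewrite /tens_act mmapZ /= mulr_algl. Qed.

HB.instance Definition _ g :=
  GRing.isScalable.Build K tensV tensV _ (tens_act g) (tens_act_is_scalable g).

Lemma tens_vec_delta a i : tens_vec (delta_mx a i) = << fmu (a, i) >>.
Proof.
rewrite /tens_vec (bigD1 (a, i)) //= big1 => [|[b j] /negPf ne].
  by rewrite mxE !eqxx scale1r addr0.
by rewrite mxE -pair_eqE /= in ne *; rewrite ne scale0r.
Qed.

Lemma tens_act_vec g v : tens_act g (tens_vec v) = tens_vec (wreath_act g v).
Proof.
rewrite [in RHS](matrix_sum_delta v) {1}/tens_vec !linear_sum /=.
under [RHS]eq_bigr => a _ do rewrite !linear_sum /=.
rewrite [RHS]pair_bigA /=; apply: eq_bigr => x _; rewrite !linearZ /=.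
congr (_ *: _).
by rewrite /tens_act mmapU /= scale1r mul1r /tens_act_word fmU big_seq1.
Qed.

Lemma tens_word (m : word) :
  << m >> = \prod_(x <- (m : seq _)) << fmu x >> :> tensV.
Proof.
case: m => s; elim: s => [|x s IHs]; first by rewrite big_nil -fmE.
rewrite /= big_cons -[\prod_(_ <- _) _]IHs malgM_def fgmulUU mulr1.
by congr << _ >>; apply/eqP; rewrite fmP fmM fmU.
Qed.

Lemma tens_ext (f1 f2 : {lrmorphism tensV -> tensV}) :
  (forall v, f1 (tens_vec v) = f2 (tens_vec v)) -> f1 =1 f2.
Proof.
move=> eqf t; rewrite (monalgE t) !linear_sum; apply: eq_bigr => m _.
have -> : << t@_m *g m >> = t@_m *: (<< m >> : tensV).
  by rewrite -mul_malgC malgM_def fgmulUU mulr1 mul1m.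
rewrite !linearZ /= tens_word !rmorph_prod.
rewrite (eq_bigr (fun x => f2 << fmu x >>)) // => -[a i] _.
by rewrite -tens_vec_delta; exact: eqf.
Qed.

Lemma tens_act1 t : tens_act 1%g t = t.
Proof.
apply: (tens_ext (f1 := tens_act 1%g) (f2 := idfun)) => v /=.
by rewrite tens_act_vec wreath_act1.
Qed.

Lemma tens_actM g h t : tens_act (g * h)%g t = tens_act g (tens_act h t).
Proof.
apply: (tens_ext (f1 := tens_act (g * h)%g) (f2 := tens_act g \o tens_act h)).
by move=> v /=; rewrite !tens_act_vec wreath_actM.
Qed.

Definition tens_action : alg_action W tensV :=
  AlgAction (alg_act := fun g => tens_act g) tens_act1 tens_actM.

Local Notation smashTV := (smash tens_action).

Variables (k : K) (c : gT -> K).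

Definition sra_relator u v : smashTV :=
  smash_alg _ (tens_vec u * tens_vec v - tens_vec v * tens_vec u)
  - omegaV u v *: 1
  - \sum_(s : W | symplectic_reflection s)
       (refl_value k c s * omega_s s u v) *: smash_grp _ s.

Definition sra : Type :=
  quot_alg (fun x : smashTV => exists u v, x = sra_relator u v).

HB.instance Definition _ := GRing.PzRing.on sra.
HB.instance Definition _ := GRing.Lmodule.on sra.

Definition sra_grp (g : W) : sra := quot_proj _ (smash_grp _ g).
Definition sra_vec (v : V) : sra := quot_proj _ (smash_alg _ (tens_vec v)).

End SymplecticReflections.

(* -------------------------------------------------------------------- *)
(* Partitions of N and the Specht module V_lam, realized as in Fulton and *)
(* Harris by the Young symmetrizer of the tableau of shape lam that is    *)
(* filled row by row with 0, ..., N-1.  Since MathComp multiplies         *)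
(* permutations from left to right and lets representations act on row    *)
(* vectors from the right, the left ideal C[S_N] a_lam b_lam for the      *)
(* usual product is the right ideal generated by b_lam a_lam here.        *)

Definition is_partition (N : nat) (lam : seq nat) : bool :=
  [&& sorted geq lam, 0%N \notin lam & sumn lam == N].

Definition rectangle (lam : seq nat) : bool := constant lam.

Section Specht.
Variables (K : fieldType) (N : nat) (lam : seq nat).

Definition row_group : {set 'S_N} :=
  [set s : 'S_N | [forall i, reshape_index lam (s i) == reshape_index lam i]].
Definition col_group : {set 'S_N} :=
  [set s : 'S_N | [forall i, reshape_offset lam (s i) == reshape_offset lam i]].

Local Notation aG := (regular_repr K [set: 'S_N]).

Definition young_symmetrizer : 'M[K]_#|[set: 'S_N]| :=
  (\sum_(s in col_group) (-1) ^+ s *: aG s) *m (\sum_(s in row_group) aG s).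

Definition specht :=
  submod_repr (cyclic_mx_module aG (gring_row young_symmetrizer)).

End Specht.

Definition has_young_diagram (K : fieldType) (N d : nat)
  (rW : mx_representation K [set: 'S_N] d) (lam : seq nat) : Prop :=
  is_partition N lam /\ mx_rsim rW (specht K N lam).

(* An algebra morphism sra -> 'M_d is a left module structure on column   *)
(* vectors; reading rW on columns instead of rows replaces it by its dual *)
(* module, to which it is isomorphic.                                     *)
Definition extends_to_sra (K : fieldType) (gT : finGroupType) (N d : nat)
  (rL : mx_representation K [set: gT] 2) (k : K) (c : gT -> K)
  (rW : mx_representation K [set: 'S_N] d) : Prop :=
  exists Phi : {rmorphism sra N rL k c -> 'M[K]_d},
    scalable Phi /\
    forall s : 'S_N, Phi (sra_grp rL k c (wreath_perm gT s)) = rW s.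

(* Main.v *)
(* Let [x_i] be [x] in Gamma placed in the i-th factor.  The sum [T] of all
   transpositions acts on [W] by a scalar, and expanding [[x_a, [x_b, T]] = 0]
   gives [(x_a - x_b)^2 = 0]; as [x_a] and [x_b] commute and have finite order,
   [x_a = x_b] on [W].  Hence [x_a] commutes with [S_N] and is a scalar by
   Schur.  If [x <> 1], then [1 - x] is invertible on [L], so [V] acts by 0, and
   the relation for a symplectic basis of the i-th summand says that the
   Jucys-Murphy sum [sum_(j != i) s_ij] acts by a scalar, since [k <> 0].  (If
   Gamma is trivial, a trace argument shows that there is no such [W].)  Finally
   let [y = b a] be the Young symmetrizer and [i] the first box of row [r]: the
   coefficient of 1 in [y * sum_(j != i) s_ij] is [lam_r] minus the number of
   rows, while that of [y] is 1, so all the [lam_r] are equal. *)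
Require Import Defs.
From HB Require Import structures.
From mathcomp Require Import all_boot all_order all_algebra all_fingroup.
From mathcomp Require Import all_character.
From mathcomp Require Import reals complex monalg ring.

Set Implicit Arguments.
Unset Strict Implicit.
Unset Printing Implicit Defensive.

Import GRing.Theory Num.Theory.
Local Open Scope ring_scope.

(** * Coefficients of the Young symmetrizer *)

Section Tableau.

Variables (N : nat) (lam : seq nat).
Hypothesis lamP : is_partition N lam.

Local Notation row i := (reshape_index lam i).
Local Notation col i := (reshape_offset lam i).

Lemma sumn_shape : sumn lam = N.
Proof. by case/and3P: lamP => _ _ /eqP. Qed.

Lemma box_inj (i j : 'I_N) : row i = row j -> col i = col j -> i = j.
Proof.
move=> eq_row eq_col; apply: val_inj => /=.
by rewrite -(reshape_indexK lam i) eq_row eq_col reshape_indexK.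
Qed.

Lemma row_lt (i : 'I_N) : (row i < size lam)%N.
Proof. by apply: reshape_indexP; rewrite sumn_shape. Qed.

Lemma col_lt (i : 'I_N) : (col i < nth 0 lam (row i))%N.
Proof. by apply: reshape_offsetP; rewrite sumn_shape. Qed.

Lemma box_lt r c : (c < nth 0 lam r)%N -> (flatten_index lam r c < N)%N.
Proof. by rewrite -sumn_shape => /flatten_indexP. Qed.

Lemma boxP r c : (c < nth 0 lam r)%N -> exists i : 'I_N, row i = r /\ col i = c.
Proof.
move=> lt_c; exists (Ordinal (box_lt lt_c)) => /=.
by rewrite flatten_indexKl // flatten_indexKr.
Qed.

Lemma shape_gt0 r : (r < size lam)%N -> (0 < nth 0 lam r)%N.
Proof.
move=> lt_r; have /and3P[_ lam0 _] := lamP.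
by rewrite lt0n; apply: contraNneq lam0 => <-; apply: mem_nth.
Qed.

Lemma shape_geq r s : (r <= s)%N -> (s < size lam)%N ->
  (nth 0 lam s <= nth 0 lam r)%N.
Proof.
move=> le_rs lt_s; have /and3P[lam_sorted _ _] := lamP.
have geq_trans : transitive geq by move=> x y z /[swap]; exact: leq_trans.
apply: (sorted_leq_nth geq_trans leqnn 0 lam_sorted) => //.
by rewrite inE (leq_ltn_trans le_rs).
Qed.

Lemma card_row r : #|[set i : 'I_N | row i == r]| = nth 0 lam r.
Proof.
pose f (c : 'I_(nth 0 lam r)) : 'I_N := Ordinal (box_lt (ltn_ord c)).
have f_inj : injective f.
  move=> c1 c2 /(congr1 (fun i : 'I_N => col i)) /=.
  by rewrite !flatten_indexKr // => /val_inj.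
rewrite -[RHS]card_ord -cardsT -(card_imset _ f_inj).
apply: eq_card => i; rewrite !inE.
apply/eqP/imsetP=> [eq_r | [c _ ->]]; last by rewrite /= flatten_indexKl.
have lt_c : (col i < nth 0 lam r)%N by rewrite -eq_r col_lt.
exists (Ordinal lt_c) => //; apply: val_inj => /=.
by rewrite -eq_r reshape_indexK.
Qed.

Lemma row_groupP (s : 'S_N) :
  reflect (forall i, row (s i) = row i) (s \in row_group N lam).
Proof. by rewrite inE; apply: (iffP forallP) => rs i; apply/eqP. Qed.

Lemma col_groupP (s : 'S_N) :
  reflect (forall i, col (s i) = col i) (s \in col_group N lam).
Proof. by rewrite inE; apply: (iffP forallP) => rs i; apply/eqP. Qed.

Lemma row_group1 : 1%g \in row_group N lam.
Proof. by apply/row_groupP => i; rewrite perm1. Qed.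

Lemma col_group1 : 1%g \in col_group N lam.
Proof. by apply/col_groupP => i; rewrite perm1. Qed.

(** [q] keeps columns; since [p] and [q * p] keep rows, so does [q], and a box is determined by its
    row and column. *)
Lemma col_row_mul_in_row (q p : 'S_N) : q \in col_group N lam ->
  p \in row_group N lam -> (q * p)%g \in row_group N lam -> q = 1%g.
Proof.
move=> /col_groupP qC /row_groupP pR /row_groupP qpR; apply/permP => i.
by rewrite perm1; apply: box_inj; rewrite // -pR -permM qpR.
Qed.

Lemma col_row_mul_in_col (q p : 'S_N) : q \in col_group N lam ->
  p \in row_group N lam -> (q * p)%g \in col_group N lam -> p = 1%g.
Proof.
move=> /col_groupP qC /row_groupP pR /col_groupP qpC; apply/permP => i.
rewrite perm1; apply: box_inj => //.
by have := qpC (q^-1%g i); rewrite permM permKV -[RHS]qC permKV.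
Qed.

(** If [s = q * p], then [q x] and [q y] share a column, and also a row because [p] keeps rows;
    hence [q x = q y]. *)
Lemma col_row_mul_neq (q p s : 'S_N) (x y : 'I_N) : q \in col_group N lam ->
  p \in row_group N lam -> x != y -> col x = col y -> row (s x) = row (s y) ->
  s != (q * p)%g.
Proof.
move=> /col_groupP qC /row_groupP pR ne_xy eq_col eq_row.
apply: contraNneq ne_xy => s_qp; apply/eqP/(@perm_inj _ q); apply: box_inj.
  by rewrite -pR -[in RHS]pR -!permM -s_qp.
by rewrite !qC.
Qed.

Variable K : fieldType.

Local Notation aG := (regular_repr K [set: 'S_N]).

(** The coefficient of [s] in the Young symmetrizer, viewed as an element of the group algebra. *)
Definition young_coef (s : 'S_N) : K :=
  \sum_(q in col_group N lam) \sum_(p in row_group N lam)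
    ((q * p)%g == s)%:R * (-1) ^+ q.

Lemma young_coef_row s : s \in row_group N lam -> young_coef s = 1.
Proof.
move=> sR; rewrite /young_coef (bigD1 1%g) ?col_group1 //=.
rewrite (bigD1 s) //= mul1g eqxx odd_perm1 mulr1.
rewrite big1 ?addr0 => [|p /andP[_ /negPf ps]]; last by rewrite mul1g ps mul0r.
rewrite big1 ?addr0 // => q /andP[qC q1]; apply: big1 => p pR.
case: eqP => [qp_s|_]; last by rewrite mul0r.
by rewrite -qp_s in sR; rewrite (col_row_mul_in_row qC pR sR) eqxx in q1.
Qed.

Lemma young_coef_col s : s \in col_group N lam -> young_coef s = (-1) ^+ s.
Proof.
move=> sC; rewrite /young_coef (bigD1 s) //=.
rewrite (bigD1 1%g) ?row_group1 //= mulg1 eqxx mul1r.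
rewrite big1 ?addr0 => [|p /andP[pR p1]]; last first.
  by rewrite -[X in _ == X]mulg1 (inj_eq (mulgI s)) (negPf p1) mul0r.
rewrite big1 ?addr0 // => q /andP[qC qs]; apply: big1 => p pR.
case: eqP => [qp_s|_]; last by rewrite mul0r.
rewrite -qp_s in sC; have p1 := col_row_mul_in_col qC pR sC.
by rewrite -qp_s p1 mulg1 eqxx in qs.
Qed.

Lemma young_coef_collision (s : 'S_N) (x y : 'I_N) : x != y ->
  col x = col y -> row (s x) = row (s y) -> young_coef s = 0.
Proof.
move=> ne_xy eq_col eq_row; apply: big1 => q qC; apply: big1 => p pR.
by rewrite eq_sym (negPf (col_row_mul_neq qC pR ne_xy eq_col eq_row)) mul0r.
Qed.

(** If [i] and [j] share neither row nor column, a third box at a corner of the rectangle they span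
    produces a collision, so the coefficient vanishes. *)
Lemma young_coef_tperm (i j : 'I_N) : i != j -> col i = 0%N ->
  young_coef (tperm i j) = (row i == row j)%:R - (col i == col j)%:R.
Proof.
move=> ne_ij col_i.
have [eq_row|ne_row] := eqVneq (row i) (row j).
  have ne_col : col i != col j.
    by apply: contraNneq ne_ij => eq_col; apply/eqP/box_inj.
  rewrite (negPf ne_col) subr0; apply/young_coef_row/row_groupP => m.
  by case: tpermP => // ->.
have [eq_col|ne_col] := eqVneq (col i) (col j).
  rewrite young_coef_col ?odd_tperm ?ne_ij ?expr1 ?add0r //.
  by apply/col_groupP => m; case: tpermP => // ->.
rewrite subrr.
(* Lower rows are no longer than upper ones, so there is a box in row [row i] and column [col j];
   the transposition moves [j] into its row. *)
have [le_ij|lt_ji] := leqP (row i) (row j).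
  have [|m [row_m col_m]] := @boxP (row i) (col j).
    by apply: leq_trans (col_lt j) _; rewrite shape_geq ?row_lt.
  have ne_im : i != m by apply: contraNneq ne_col => ->; rewrite col_m.
  have ne_jm : j != m by apply: contraNneq ne_row => ->; rewrite row_m.
  by apply: (@young_coef_collision _ j m); rewrite ?tpermR ?tpermD.
(* Now the first box of the row of [j] is used; it shares the column of [i] because [col i = 0]. *)
have [|m [row_m col_m]] := @boxP (row j) 0%N.
  by rewrite shape_gt0 ?row_lt.
have ne_jm : j != m by apply: contraNneq ne_col => ->; rewrite col_m col_i.
have ne_im : i != m by apply: contraNneq ne_row => ->; rewrite row_m.
by apply: (@young_coef_collision _ i m); rewrite ?tpermL ?tpermD ?col_i.
Qed.

(** [gring_proj 1] reads off the coefficient of the identity, and right multiplication by [s]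
    carries the term at [s^-1] there. *)
Lemma gring_proj_young (s : 'S_N) :
  gring_proj 1 (young_symmetrizer K N lam *m aG s) 0 0 = young_coef s^-1%g.
Proof.
rewrite /young_symmetrizer !mulmx_suml linear_sum summxE.
apply: eq_bigr => q _; rewrite -mulmxA mulmx_suml mulmx_sumr linear_sum summxE.
apply: eq_bigr => p _; rewrite -scalemxAl linearZ /= mulmxA.
rewrite -!repr_mxM ?inE // gring_projE ?inE // mxE mulrC.
rewrite eq_sym -[in RHS](inj_eq (mulIg s)) mulVg.
by case: (_ == 1%g); rewrite ?mulr1n ?mulr0n mxE.
Qed.

End Tableau.

(** * Jucys-Murphy elements on Specht modules *)

Section SpechtScalar.

Variables (K : numFieldType) (N : nat) (lam : seq nat).

(** The Young symmetrizer generates the Specht module: apply both sides to this generator and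
    compare the coefficients of the identity. *)
Lemma specht_scalar_young (I : finType) (P : pred I) (X : I -> 'S_N) (t : K) :
  \sum_(i | P i) specht K N lam (X i) = t%:M ->
  \sum_(i | P i) @young_coef N lam K (X i)^-1%g = t * @young_coef N lam K 1%g.
Proof.
pose y := gring_row (young_symmetrizer K N lam).
pose U := cyclic_mx (regular_repr K [set: 'S_N]) y.
have Uy : (y <= U)%MS by exact: cyclic_mx_id.
have X_G i : X i \in [set: 'S_N] by rewrite inE.
move=> /(congr1 (fun A => val_submod (in_submod U y *m A))).
rewrite mulmx_sumr linear_sum /=.
under eq_bigr => i _ do rewrite val_submodJ // in_submodK // -gring_row_mul.
rewrite mul_mx_scalar linearZ /= in_submodK // -linear_sum -linearZ /=.
move=> eq_row.
have: gring_proj 1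
        (\sum_(i | P i) young_symmetrizer K N lam *m regular_repr K _ (X i))
      = gring_proj 1 (t *: young_symmetrizer K N lam).
  by rewrite /gring_proj /= eq_row.
move=> /(congr1 (fun A : 'M_1 => A 0 0)); rewrite linear_sum linearZ /=.
rewrite summxE mxE -[young_symmetrizer K N lam in X in _ = X]mulmx1.
rewrite -(repr_mx1 (regular_repr K [set: 'S_N])) gring_proj_young invg1 => <-.
by apply: eq_bigr => i _; rewrite gring_proj_young.
Qed.

(* For a box [i] in the first column, the coefficient of the identity in
   [b a X_i] is (length of the row of i) - (length of the first column). *)
Lemma specht_jucys_murphy_scalar (t : K) : is_partition N lam ->
  (forall i : 'I_N, \sum_(j | j != i) specht K N lam (tperm i j) = t%:M) ->
  rectangle lam.
Proof.
move=> lamP JM_t.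
pose col0 := [set j : 'I_N | reshape_offset lam j == 0%N].
(* The omitted index [j = i] gives the [- 1]; the corrections for rows and for columns cancel
   below. *)
have count_mates (f : nat -> nat) (i : 'I_N) :
    \sum_(j | j != i) (f i == f j)%:R = #|[set j : 'I_N | f j == f i]|%:R - 1 :> K.
  rewrite -sum1_card natr_sum [X in X - 1](bigD1 i) ?inE //= addrAC subrr add0r.
  rewrite big_mkcond [RHS]big_mkcond; apply: eq_bigr => j _.
  by rewrite inE [f i == _]eq_sym; case: (f j == f i); case: (j == i).
have row_col (i : 'I_N) : reshape_offset lam i = 0%N ->
    t = (nth 0%N lam (reshape_index lam i))%:R - #|col0|%:R.
  move=> col_i; have := specht_scalar_young (JM_t i).
  rewrite young_coef_row ?row_group1 // mulr1 => <-.
  have coef j : j != i -> @young_coef N lam K (tperm i j)^-1%g =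
      (reshape_index lam i == reshape_index lam j)%:R
      - (reshape_offset lam i == reshape_offset lam j)%:R.
    by rewrite eq_sym tpermV => ij; rewrite young_coef_tperm.
  rewrite (eq_bigr _ coef) sumrB (count_mates (reshape_index lam)).
  rewrite (count_mates (reshape_offset lam)).
  rewrite card_row // opprB addrA subrK.
  by rewrite col_i.
have nth_eq r s : (r < size lam)%N -> (s < size lam)%N ->
    nth 0%N lam r = nth 0%N lam s.
  move=> /(shape_gt0 lamP)/(boxP lamP)[i [row_i col_i]].
  move=> /(shape_gt0 lamP)/(boxP lamP)[j [row_j col_j]].
  (* The scalar [t] is common to both rows, and in characteristic 0 the lengths can be compared
     inside [K]. *)
  apply/eqP; rewrite -(eqr_nat K); apply/eqP/(addIr (- #|col0|%:R)).
  by rewrite -row_i -row_j -!row_col.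
rewrite /rectangle; case: lam nth_eq => //= x s nth_eq.
apply/(all_nthP 0%N) => r lt_r; apply/eqP.
exact: (nth_eq r.+1 0%N).
Qed.

End SpechtScalar.

(** The Jucys-Murphy sums at different indices are conjugate, so one being scalar makes all of them
    the same scalar; the isomorphism [B] carries this to the Specht module. *)
Lemma jucys_murphy_scalar_rectangle (K : numFieldType) (N d : nat)
    (lam : seq nat) (rW : mx_representation K [set: 'S_N] d) (i : 'I_N) (t : K) :
  has_young_diagram rW lam ->
  \sum_(j | j != i) rW (tperm i j) = t%:M -> rectangle lam.
Proof.
move=> [lamP /mx_rsim_sym[B _ freeB homB]] JM_i.
have S_N (s : 'S_N) : s \in [set: 'S_N] by rewrite inE.
apply: (specht_jucys_murphy_scalar (t := t) lamP) => k.
apply: (row_free_inj freeB); rewrite mul_scalar_mx -mul_mx_scalar -JM_i.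
have -> : \sum_(j | j != i) rW (tperm i j) = \sum_(j | j != k) rW (tperm k j).
  pose s := tperm i k; have [-> //|ne_ki] := eqVneq k i.
  rewrite [RHS](reindex_inj (@perm_inj _ s)) /=.
  transitivity (rW s^-1%g *m (\sum_(j | j != i) rW (tperm i j)) *m rW s).
    rewrite JM_i mul_mx_scalar -scalemxAl -repr_mxM ?S_N // mulVg.
    by rewrite repr_mx1 scalemx1.
  rewrite mulmx_sumr mulmx_suml; apply: eq_big => [j|j _].
    by rewrite -(inj_eq (@perm_inj _ s)) tpermL.
  by rewrite -!repr_mxM ?S_N // -mulgA -conjgE tpermJ tpermL.
by rewrite mulmx_suml mulmx_sumr; apply: eq_bigr => j _; rewrite homB.
Qed.

(** * Schur's lemma and unipotent matrices of finite order *)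

(** For an eigenvalue [a] of [A], the matrix [A - a] centralizes the module and kills a nonzero
    vector, so by Schur it is 0. *)
Lemma irr_centralizer_scalar (K : numClosedFieldType) (G : finGroupType) (n : nat)
    (rG : mx_representation K [set: G] n) (A : 'M[K]_n) : mx_irreducible rG ->
  (forall x, A *m rG x = rG x *m A) -> exists a, A = a%:M.
Proof.
move=> irrG cA; have [_ nz1 _] := irrG.
have n_gt0 : (0 < n)%N.
  by case: n nz1 {rG irrG A cA} => // /eqP[]; apply/matrixP; case.
have [a /eigenvalueP[v vA nz_v]] := spectral.eigenvalue_closed A n_gt0.
exists a; apply/eqP; rewrite -subr_eq0; apply: contraNT nz_v => nz_Aa.
have cent_Aa : centgmx rG (A - a%:M).
  by apply/centgmxP => x _; rewrite mulmxBl mulmxBr cA scalar_mxC.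
have /row_free_inj inj_Aa : row_free (A - a%:M).
  by rewrite row_free_unit (mx_Schur irrG).
by apply/eqP/inj_Aa; rewrite mul0mx mulmxBr vA mul_mx_scalar subrr.
Qed.

(** With [A = 1 + e] and [e * e = 0], the power [A ^+ n] is [1 + e *+ n]; in characteristic 0 this
    forces [e = 0]. *)
Lemma unipotent_finite_order (K : numFieldType) (d n : nat) (A : 'M[K]_d) :
  (0 < n)%N -> (A - 1) * (A - 1) = 0 -> A ^+ n = 1 -> A = 1.
Proof.
move=> n_gt0 sqA0 An1; set e := A - 1 in sqA0.
have A_e : A = 1 + e by rewrite addrC subrK.
have powA m : A ^+ m = 1 + e *+ m.
  elim: m => [|m IHm]; first by rewrite addr0.
  rewrite exprS IHm A_e mulrDr mulr1 mulrnAr mulrDl mul1r sqA0 addr0.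
  by rewrite -addrA -mulrS.
have := powA n; rewrite An1 -[X in X = _]addr0 => /addrI/esym/eqP.
rewrite -scaler_nat scaler_eq0 pnatr_eq0 -[n == 0%N]negbK -lt0n n_gt0 /=.
by rewrite A_e => /eqP->; rewrite addr0.
Qed.

(** * The action of the wreath product *)

Section Wreath.

Variables (gT : finGroupType) (N : nat).
Implicit Types (s t : 'S_N) (i j k : 'I_N) (x y : gT).

Lemma wreath_permM : {morph @wreath_perm gT N : s t / (s * t)%g}.
Proof.
by move=> s t; congr pair; apply/ffunP => i; rewrite !ffunE mulg1.
Qed.

Lemma wreath_baseM i : {morph @wreath_base gT N i : x y / (x * y)%g}.
Proof.
move=> x y; congr pair; first by rewrite /= mulg1.
by apply/ffunP => j; rewrite !ffunE perm1; case: eqP; rewrite ?mulg1.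
Qed.

Lemma wreath_base1 i : wreath_base i 1%g = 1%g :> wreath gT N.
Proof. by congr pair; apply/ffunP => j; rewrite !ffunE if_same. Qed.

Lemma wreath_baseV i x : wreath_base i x^-1%g = (wreath_base i x)^-1%g.
Proof.
by apply/eqP; rewrite eq_sym eq_invg_mul -wreath_baseM mulgV wreath_base1.
Qed.

Lemma wreath_base_comm i j x y : i != j ->
  (wreath_base i x * wreath_base j y = wreath_base j y * wreath_base i x)%g.
Proof.
move=> ne_ij; congr pair; apply/ffunP => k; rewrite !ffunE !perm1.
by have [->|] := eqVneq k i; rewrite ?(negPf ne_ij) ?mulg1 ?mul1g.
Qed.

Lemma wreath_perm_base s k x :
  (wreath_perm gT s * wreath_base (s k) x = wreath_base k x * wreath_perm gT s)%g.
Proof.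
congr pair; first by rewrite /= mulg1 mul1g.
by apply/ffunP => i; rewrite !ffunE (inj_eq perm_inj) mulg1 mul1g.
Qed.

End Wreath.

(** * The base group acts by scalars on an irreducible module *)

Section BaseActsByScalars.

Variables (K : numClosedFieldType) (gT : finGroupType) (N d : nat).
Variable rW : mx_representation K [set: 'S_N] d.
Hypothesis rW_irr : mx_irreducible rW.
Variable rho : wreath gT N -> 'M[K]_d.
Hypothesis rho1 : rho 1%g = 1.
Hypothesis rhoM : {morph rho : g h / (g * h)%g >-> g * h}.
Hypothesis rho_perm : forall s, rho (wreath_perm gT s) = rW s.

Local Notation P s := (rho (wreath_perm gT s)).
Local Notation X := (fun x i => rho (wreath_base i x)).

Lemma rho_expg g n : rho (g ^+ n)%g = rho g ^+ n.
Proof. by elim: n => [|n IHn]; rewrite ?rho1 // expgS rhoM IHn exprS. Qed.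

Lemma rho_perm_base (s : 'S_N) k x : P s * X x (s k) = X x k * P s.
Proof. by rewrite -!rhoM wreath_perm_base. Qed.

Lemma rho_base_comm i j x y : i != j -> X x i * X y j = X y j * X x i.
Proof. by move=> ne_ij; rewrite -!rhoM wreath_base_comm. Qed.

(** Ordered pairs, diagonal included, are permuted by [S_N], so the sum is central and Schur
    applies; the diagonal contributes only identities. *)
Lemma sum_tperm_scalar : exists t, \sum_(p : 'I_N * 'I_N) P (tperm p.1 p.2) = t%:M.
Proof.
apply: (irr_centralizer_scalar rW_irr) => s; rewrite -rho_perm.
rewrite mulmx_suml mulmx_sumr.
have sJ_inj : injective (fun p : 'I_N * 'I_N => (s p.1, s p.2)).
  by move=> [i j] [k l] [/perm_inj-> /perm_inj->].
rewrite [RHS](reindex_inj sJ_inj); apply: eq_bigr => p _ /=.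
by rewrite -tpermJ -[LHS]rhoM -[RHS]rhoM -!wreath_permM conjgC.
Qed.

(* [sum_(i, j) s_ij] is scalar, so its double commutator with [x_a] and [x_b]
   vanishes; only the two terms [s_ab] contribute, giving [s_ab (x_a - x_b)^2]. *)
Lemma sqr_base_sub (a b : 'I_N) x : (X x a - X x b) * (X x a - X x b) = 0.
Proof.
have [->|ne_ab] := eqVneq a b; first by rewrite subrr mul0r.
pose com (B A : 'M[K]_d) := B * A - A * B.
have comD B : {morph com B : A1 A2 / A1 + A2}.
  by move=> A1 A2; rewrite /com mulrDr mulrDl opprD addrACA.
have com0 B : com B 0 = 0 by rewrite /com mulr0 mul0r subrr.
pose D A := com (X x a) (com (X x b) A).
have DB : {morph D : A1 A2 / A1 + A2} by move=> A1 A2; rewrite /D !comD.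
have D0 : D 0 = 0 by rewrite /D !com0.
have [t sum_t] := sum_tperm_scalar.
have : D (\sum_(p : 'I_N * 'I_N) P (tperm p.1 p.2)) = 0.
  by rewrite sum_t /D [com _ t%:M]/com [_ * t%:M]scalar_mxC subrr com0.
rewrite (big_morph D DB D0) (bigD1 (a, b)) // (bigD1 (b, a)) /=; last first.
  by rewrite xpair_eqE negb_and eq_sym ne_ab.
rewrite big1 ?addr0 => [|[i j] /= /andP[ne1 ne2]]; last first.
  (* If [s] fixes [b], the inner commutator is 0. Otherwise [s] moves [b] but fixes [a], so [x_a]
     commutes with both [s] and [x_b], and the outer commutator is 0. *)
  set s := tperm i j; have [sb|sb] := eqVneq (s b) b.
    rewrite /D; have -> : com (X x b) (P s) = 0; last exact: com0.
    by rewrite /com -rho_perm_base sb subrr.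
  have b_ij : (b == i) || (b == j).
    apply: contraR sb; rewrite negb_or ![b == _]eq_sym => /andP[ne_ib ne_jb].
    by rewrite /s tpermD.
  have sa : s a = a.
    rewrite /s tpermD //; apply: contraNneq ne_ab => eq_a; move: b_ij ne1 ne2;
    by rewrite !xpair_eqE -eq_a !eqxx /= ?andbT ![_ == b]eq_sym ?(eq_sym b);
      do 2! case: eqP.
  have cXs : X x a * P s = P s * X x a by rewrite -rho_perm_base sa.
  have cXb := rho_base_comm x x ne_ab.
  rewrite /D {1}/com; apply/eqP; rewrite subr_eq0 /com mulrBr mulrBl; apply/eqP.
  by congr (_ - _); rewrite mulrA ?cXb ?cXs -!mulrA ?cXs ?cXb.
(* The two surviving terms coincide, so twice one of them vanishes. *)
rewrite [tperm b a]tpermC => DD0.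
have {DD0} /eqP DP0 : D (P (tperm a b)) = 0.
  by apply/eqP; move/eqP: DD0; rewrite -mulr2n -scaler_nat scaler_eq0 pnatr_eq0.
set s := tperm a b in DP0.
have aXs : X x a * P s = P s * X x b by rewrite -rho_perm_base tpermL.
have bXs : X x b * P s = P s * X x a by rewrite -rho_perm_base tpermR.
have cab := rho_base_comm x x ne_ab.
set e := X x a - X x b in bXs *.
have com_b : com (X x b) (P s) = P s * e by rewrite /com bXs -mulrBr.
have com_a : com (X x a) (P s * e) = - (P s * (e * e)).
  have ce : e * X x a = X x a * e by rewrite /e mulrBl mulrBr cab.
  by rewrite /com mulrA aXs -!mulrA ce -mulrBr -mulrBl -opprB mulNr mulrN.
move: DP0; rewrite /D com_b com_a oppr_eq0 => /eqP Pee0.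
have PP : P s * P s = 1 by rewrite -rhoM -wreath_permM tperm2 -rho1.
by rewrite -[e * e]mul1r -PP -mulrA Pee0 mulr0.
Qed.

(** The operator [U] of [x_a x_b^-1] satisfies [(U - 1)^2 = 0] by [sqr_base_sub], and it has finite
    order. *)
Lemma rho_base_eq (a b : 'I_N) x : X x a = X x b.
Proof.
have [->//|ne_ab] := eqVneq a b.
pose U := rho (wreath_base a x * (wreath_base b x)^-1)%g.
have U_Xb : U * X x b = X x a by rewrite -rhoM mulgKV.
have comm_ab : commute (wreath_base a x : wreath gT N) (wreath_base b x)^-1%g.
  by apply/commuteV/wreath_base_comm.
have Xb_unit : X x b * rho (wreath_base b x)^-1%g = 1 by rewrite -rhoM mulgV.
suff U1 : U = 1 by rewrite -U_Xb U1 mul1r.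
apply: (@unipotent_finite_order _ _ #[wreath_base a x * (wreath_base b x)^-1]%g).
- exact: order_gt0.
- have -> : U - 1 = (X x a - X x b) * rho (wreath_base b x)^-1%g.
    by rewrite mulrBl -U_Xb -mulrA Xb_unit mulr1.
  have comm_d : rho (wreath_base b x)^-1%g * (X x a - X x b) =
      (X x a - X x b) * rho (wreath_base b x)^-1%g.
    by rewrite mulrBl mulrBr -!rhoM comm_ab mulVg mulgV.
  by rewrite mulrA -[_ * _ * (_ - _)]mulrA comm_d mulrA sqr_base_sub !mul0r.
- by rewrite -rho_expg expg_order rho1.
Qed.

(** As [x_i] does not depend on [i], it commutes with [S_N] and Schur applies; the scalar is nonzero
    because [x_i] is invertible on a nonzero space. *)
Lemma rho_base_scalar i x : exists2 a, a != 0 & rho (wreath_base i x) = a%:M.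
Proof.
have [a Xa] : exists a, X x i = a%:M.
  apply: (irr_centralizer_scalar rW_irr) => s; rewrite -rho_perm.
  by rewrite -[LHS]/(X x i * P s) -rho_perm_base (rho_base_eq (s i) i).
exists a => //; apply/eqP => a0.
have : X x i * rho (wreath_base i x)^-1%g = 1 by rewrite -rhoM mulgV.
rewrite Xa a0 raddf0 mul0r => /esym/eqP.
by have [_ nz1 _] := rW_irr; rewrite (negPf nz1).
Qed.

End BaseActsByScalars.

(** * Symplectic reflections *)

Section Reflections.

Variables (gT : finGroupType) (N : nat).
Implicit Types (i j m : 'I_N) (x : gT).

Lemma refl_S1 i j x : (refl_S i j x).1 = tperm i j.
Proof. by rewrite /refl_S -wreath_baseV /= !mulg1. Qed.

(** A pair has its base part to the left of its permutation, and
    [s_ij x_i x_j^-1 = x_j x_i^-1 s_ij]; hence [x] sits at [j]. *)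
Lemma refl_S2 i j x m : i != j ->
  (refl_S i j x).2 m = if m == j then x else if m == i then x^-1%g else 1%g.
Proof.
move=> ne_ij; rewrite /refl_S -wreath_baseV !ffunE /= mul1g !mulg1.
have [->|ne_mj] := eqVneq m j.
  by rewrite tpermR eqxx (negPf ne_ij) mulg1.
have [->|ne_mi] := eqVneq m i.
  by rewrite tpermL eq_sym (negPf ne_ij) eqxx mul1g.
by rewrite tpermD ?(negPf ne_mi) ?(negPf ne_mj) ?mulg1 // eq_sym.
Qed.

Lemma refl_S_sym i j x : i != j -> refl_S j i x^-1%g = refl_S i j x.
Proof.
move=> ne_ij; rewrite [LHS]surjective_pairing [RHS]surjective_pairing.
congr pair; first by rewrite !refl_S1 tpermC.
have ne_ji : j != i by rewrite eq_sym.
apply/ffunP => m; rewrite !refl_S2 // invgK.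
by have [->|] := eqVneq m i; first by rewrite (negPf ne_ij).
Qed.

Variables (K : numFieldType) (rL : mx_representation K [set: gT] 2).
Local Notation act := (wreath_act rL).

Lemma col_wreath_act (g : wreath gT N) (v : 'M[K]_(2, N)) m :
  col m (act g v) = rL (g.2 m) *m col (g.1 m) v.
Proof.
apply/matrixP => a b; rewrite ord1 !mxE.
by apply: eq_bigr => e _; rewrite !mxE.
Qed.

Lemma wreath_act_refl_S i j x v : i != j ->
  [/\ col i (act (refl_S i j x) v) = rL x^-1%g *m col j v,
      col j (act (refl_S i j x) v) = rL x *m col i v &
      forall m, m != i -> m != j -> col m (act (refl_S i j x) v) = col m v].
Proof.
move=> ne_ij; split=> [||m ne_mi ne_mj]; rewrite col_wreath_act refl_S1 refl_S2 //.
- by rewrite (negPf ne_ij) eqxx tpermL.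
- by rewrite eqxx tpermR.
by rewrite (negPf ne_mi) (negPf ne_mj) tpermD 1?eq_sym // repr_mx1 mul1mx.
Qed.

Lemma col_eqP (A B : 'M[K]_(2, N)) : (forall m, col m A = col m B) -> A = B.
Proof.
move=> eqAB; apply: trmx_inj; apply/row_matrixP => m.
by rewrite -!tr_col eqAB.
Qed.

Lemma wreath_act_refl_SK i j x : i != j -> involutive (act (refl_S i j x)).
Proof.
move=> ne_ij v; have [Ei Ej Em] := wreath_act_refl_S x (act (refl_S i j x) v) ne_ij.
have [Ei' Ej' Em'] := wreath_act_refl_S x v ne_ij.
apply: col_eqP => m.
have [->|ne_mi] := eqVneq m i.
  by rewrite Ei Ej' mulmxA -repr_mxM ?inE // mulVg repr_mx1 mul1mx.
have [->|ne_mj] := eqVneq m j.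
  by rewrite Ej Ei' mulmxA -repr_mxM ?inE // mulgV repr_mx1 mul1mx.
by rewrite Em // Em'.
Qed.

Lemma id_minusE (g : wreath gT N) v : id_minus rL g v = v - act g v.
Proof. by rewrite !lfunE /= !lfunE /= !lfunE. Qed.

(** For an involution [g], the projection onto [Im (Id - g)] along [Ker (Id - g)] is
    [(Id - g) / 2]. *)
Lemma omega_s_involution (g : wreath gT N) u v : involutive (act g) ->
  omega_s rL g u v = omegaV (2^-1 *: (u - act g u)) (2^-1 *: (v - act g v)).
Proof.
move=> gK; pose U := limg (id_minus rL g); pose V := lker (id_minus rL g).
have nz2 : 2 != 0 :> K by rewrite pnatr_eq0.
(* [Id - g] acts as 2 on its own image. *)
have UV0 : (U :&: V = 0)%VS.
  apply/eqP; rewrite -subv0; apply/subvP => w.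
  rewrite memv_cap memv_ker memv0 => /andP[/memv_imgP[w' _ ->]].
  rewrite [id_minus _ _ w']id_minusE; set z := w' - _.
  have -> : id_minus rL g z = 2 *: z.
    by rewrite id_minusE /z linearB /= gK -[act g w' - w']opprB opprK scaler_nat.
  by rewrite scaler_eq0 (negPf nz2).
suff pE w : daddv_pi U V w = 2^-1 *: (w - act g w) by rewrite /omega_s !pE.
have decomp : w = 2^-1 *: (w - act g w) + 2^-1 *: (w + act g w).
  rewrite -scalerDr addrACA addNr addr0 -mulr2n -scaler_nat scalerA.
  by rewrite mulVf ?scale1r.
have inU : 2^-1 *: (w - act g w) \in U.
  by rewrite memvZ // -id_minusE memv_img ?memvf.
have inV : 2^-1 *: (w + act g w) \in V.
  by rewrite memvZ // memv_ker id_minusE linearD /= gK [act g w + w]addrC subrr.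
rewrite [in LHS]decomp linearD /= daddv_pi_id //.
suff -> : daddv_pi U V (2^-1 *: (w + act g w)) = 0 by rewrite addr0.
have := daddv_pi_add UV0 (subvP (addvSr U V) _ inV).
have VU0 : (V :&: U = 0)%VS by rewrite capvC.
by rewrite (daddv_pi_id VU0 inV) -[X in _ = X]add0r => /addIr.
Qed.

Definition embed i (y : 'cV[K]_2) : 'M[K]_(2, N) := y *m delta_mx 0 i.

Fact embed_is_linear i : linear (embed i).
Proof. by move=> a y z; rewrite /embed mulmxDl scalemxAl. Qed.

HB.instance Definition _ i :=
  GRing.isLinear.Build K 'cV[K]_2 'M[K]_(2, N) _ (embed i) (embed_is_linear i).

Lemma col_embed i y m : col m (embed i y) = if m == i then y else 0.
Proof.
apply/matrixP => a b; rewrite ord1 !mxE big_ord1 !mxE eqxx /=.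
by case: eqP => _; rewrite ?mulr1 ?mulr0 ?mxE.
Qed.

(** [Id - s] is injective on the i-th summand and already attains its whole image there, so its rank
    is 2. *)
Lemma symplectic_reflection_refl_S i j x : i != j ->
  symplectic_reflection rL (refl_S i j x).
Proof.
move=> ne_ij; set D := id_minus rL (refl_S i j x).
pose f : 'Hom('cV[K]_2, 'M[K]_(2, N)) := (D \o linfun (embed i))%VF.
have fE y : f y = D (embed i y).
  by apply: etrans (comp_lfunE _ _ _) _; congr (fun_of_lfun D _); rewrite lfunE.
have col_D v m : col m (D v) = col m v - col m (wreath_act rL (refl_S i j x) v).
  by rewrite /D id_minusE linearB.
have f_inj : lker f == 0%VS.
  apply/lker0P => y z; rewrite !fE => /(congr1 (col i)); rewrite !col_D.
  have [-> _ _] := wreath_act_refl_S x (embed i y) ne_ij.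
  have [-> _ _] := wreath_act_refl_S x (embed i z) ne_ij.
  by rewrite !col_embed eqxx [j == i]eq_sym (negPf ne_ij) mulmx0 !subr0.
suff eq_img : limg D = limg f.
  rewrite /symplectic_reflection -/D eq_img limg_dim_eq ?dimvf //.
  by rewrite (eqP f_inj) capv0.
apply/eqP; rewrite eqEsubv; apply/andP; split; last first.
  by rewrite /f limg_comp limgS ?subvf.
apply/subvP => _ /memv_imgP[v _ ->].
(* The components of [D v] at [i] and [j] are [y] and [- x y], where [y = v_i - x^-1 v_j]. *)
suff -> : D v = f (col i v - rL x^-1%g *m col j v) by rewrite memv_img ?memvf.
rewrite fE; set y := _ - _; apply: col_eqP => m; rewrite !col_D.
have [Ei Ej Em] := wreath_act_refl_S x v ne_ij.
have [Ei' Ej' Em'] := wreath_act_refl_S x (embed i y) ne_ij.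
have [->|ne_mi] := eqVneq m i.
  by rewrite Ei Ei' !col_embed eqxx [j == i]eq_sym (negPf ne_ij) mulmx0 subr0.
have [->|ne_mj] := eqVneq m j.
  rewrite Ej Ej' !col_embed eqxx [j == i]eq_sym (negPf ne_ij) sub0r mulmxBr.
  by rewrite mulmxA -repr_mxM ?inE // mulgV repr_mx1 mul1mx opprB.
by rewrite Em // Em' // !subrr.
Qed.

Lemma omegaLM (A : 'M[K]_2) y z : omegaL (A *m y) (A *m z) = \det A * omegaL y z.
Proof. by rewrite /omegaL -mul_mx_row det_mulmx. Qed.

Lemma omegaL_basis : omegaL (delta_mx 0 0) (delta_mx 1 0) = 1 :> K.
Proof.
rewrite /omegaL.
have -> : row_mx (delta_mx 0 0 : 'cV[K]_2) (delta_mx 1 0 : 'cV[K]_2) = 1%:M.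
  apply/matrixP => a b; rewrite mxE; case: splitP => k; rewrite ord1 => b_k.
  - have -> : b = 0 by apply/val_inj.
    by rewrite !mxE andbT.
  - have -> : b = 1 by apply/val_inj.
    by rewrite !mxE andbT.
exact: det1.
Qed.

Lemma omegaLZ (a : K) y z : omegaL (a *: y) (a *: z) = a ^+ 2 * omegaL y z.
Proof. by rewrite /omegaL -scale_row_mx detZ. Qed.

Lemma omegaV_sum2 i j (u v : 'M[K]_(2, N)) : i != j ->
  (forall m, m != i -> m != j -> col m u = 0 /\ col m v = 0) ->
  omegaV u v = omegaL (col i u) (col i v) + omegaL (col j u) (col j v).
Proof.
move=> ne_ij uv0; rewrite /omegaV (bigD1 i) // (bigD1 j) 1?eq_sym //=.
rewrite big1 ?addr0 // => m /andP[ne_mi ne_mj].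
have [-> ->] := uv0 m ne_mi ne_mj.
by rewrite -(scale0r 0) omegaLZ expr0n mul0r.
Qed.

(** The projection of [y] in slot [i] is [y / 2] in slot [i] and [- x y / 2] in slot [j]; as [x] has
    determinant 1, each slot contributes 1/4. *)
Lemma omega_s_refl_S i j x : i != j -> \det (rL x) = 1 ->
  omega_s rL (refl_S i j x) (embed i (delta_mx 0 0)) (embed i (delta_mx 1 0)) = 2^-1.
Proof.
move=> ne_ij det1x; rewrite omega_s_involution; last exact: wreath_act_refl_SK.
have E y := wreath_act_refl_S x (embed i y) ne_ij.
have Ei y : col i (2^-1 *: (embed i y - act (refl_S i j x) (embed i y))) = 2^-1 *: y.
  have [Ei _ _] := E y; rewrite linearZ linearB /= Ei !col_embed eqxx.
  by rewrite [j == i]eq_sym (negPf ne_ij) mulmx0 subr0.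
have Ej y : col j (2^-1 *: (embed i y - act (refl_S i j x) (embed i y))) =
    2^-1 *: - (rL x *m y).
  have [_ Ej _] := E y; rewrite linearZ linearB /= Ej !col_embed eqxx.
  by rewrite [j == i]eq_sym (negPf ne_ij) sub0r.
rewrite (omegaV_sum2 ne_ij) => [|m ne_mi ne_mj]; last first.
  have Em y : col m (2^-1 *: (embed i y - act (refl_S i j x) (embed i y))) = 0.
    by have [_ _ Em] := E y; rewrite linearZ linearB /= Em // subrr scaler0.
  by rewrite !Em.
rewrite !Ei !Ej !scalerN -!scaleNr !omegaLZ omegaLM det1x omegaL_basis sqrrN.
have half2 : 2^-1 *+ 2 = 1 :> K by rewrite -[LHS]mulr_natr mulVf ?pnatr_eq0.
by rewrite !mulr1 -mulr2n expr2 -mulrnAr half2 mulr1.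
Qed.

End Reflections.

(** * Elements of SL(2) of finite order *)

Lemma det_mx22 (R : comRingType) (A : 'M[R]_2) :
  \det A = A 0 0 * A 1 1 - A 0 1 * A 1 0.
Proof.
rewrite (expand_det_row _ 0) !big_ord_recl big_ord0 addr0 /cofactor !det_mx11.
rewrite !mxE /= expr0 expr1 mul1r mulN1r mulrN.
have -> : lift 0 0 = 1 :> 'I_2 by apply/val_inj.
by have -> : lift 1 0 = 0 :> 'I_2 by apply/val_inj.
Qed.

(* The Cayley-Hamilton identity for a matrix of determinant 1 with eigenvalue 1. *)
Lemma sqr_sub1_mx22 (R : comRingType) (A : 'M[R]_2) :
  \det A = 1 -> \det (1%:M - A) = 0 -> (A - 1%:M) *m (A - 1%:M) = 0.
Proof.
rewrite !det_mx22 !mxE /= => detA det1A.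
(* [\det (1 - A) = 1 - \tr A + \det A], so the trace is 2. *)
have trA : A 1 1 = 2 - A 0 0.
  have -> : 2 = 1 + 1 - 0 :> R by rewrite subr0.
  by rewrite -{1}detA -det1A; ring.
have ord2 (k : 'I_2) : k = 0 \/ k = 1.
  by case: k => [[|[|//]] lt_k]; [left | right]; apply/val_inj.
have lift01 : lift ord0 ord0 = 1 :> 'I_2 by apply/val_inj.
have bc : A 0 1 * A 1 0 = A 0 0 * A 1 1 - 1 by rewrite -detA; ring.
apply/matrixP => i j; rewrite !mxE big_ord_recl big_ord1 lift01 !mxE.
have ord00 : ord0 = 0 :> 'I_2 by apply/val_inj.
have [[->|->] [->|->]] := (ord2 i, ord2 j); rewrite /= ord00 !subr0.
- by rewrite bc trA; ring.
- by rewrite trA; ring.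
- by rewrite trA; ring.
by rewrite [A 1 0 * _]mulrC bc trA; ring.
Qed.

(** If [1 - x] were singular, determinant 1 would make [x] unipotent; having finite order it would
    act trivially, against faithfulness. *)
Lemma unitmx_1_sub_SL2 (K : numFieldType) (gT : finGroupType)
    (rL : mx_representation K [set: gT] 2) (x : gT) : mx_faithful rL ->
  \det (rL x) = 1 -> x != 1%g -> 1%:M - rL x \in unitmx.
Proof.
move=> rL_faithful detx1; apply: contraNT; rewrite unitmxE unitfE negbK => /eqP det0.
pose A := rL x.
have A_pow n : A ^+ n = rL (x ^+ n)%g.
  elim: n => [|n IHn]; first by rewrite repr_mx1.
  by rewrite exprS IHn expgS repr_mxM ?inE.
have sqA : (A - 1) * (A - 1) = 0 by apply: sqr_sub1_mx22.
have A1 : A = 1.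
  apply: (unipotent_finite_order (order_gt0 x) sqA).
  by rewrite A_pow expg_order repr_mx1.
rewrite -in_set1; apply: (subsetP rL_faithful).
by rewrite inE in_setT mul1mx -/A A1; apply/eqP.
Qed.

(** * Morphisms out of a quotient algebra *)

Section QuotientMorphism.

Variables (K : comNzRingType) (A : lalgType K) (X : A -> Prop) (d : nat).
Variable Phi : {rmorphism quot_alg X -> 'M[K]_d}.
Hypothesis PhiZ : scalable Phi.

Definition lift_quot (a : A) : 'M[K]_d := Phi (quot_proj X a).

Lemma lift_quotB : {morph lift_quot : a b / a - b}.
Proof. move=> a b; rewrite /lift_quot -rmorphB; congr (Phi _).
by apply: (canRL (addrK _)); rewrite -quot_projD subrK. Qed.

HB.instance Definition _ :=
  GRing.isZmodMorphism.Build A 'M[K]_d lift_quot lift_quotB.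

Lemma lift_quotM : {morph lift_quot : a b / a * b}.
Proof. by move=> a b; rewrite /lift_quot quot_projM -rmorphM. Qed.

Lemma lift_quot1 : lift_quot 1 = 1.
Proof. by rewrite /lift_quot -(rmorph1 Phi). Qed.

Lemma lift_quotZ a b : lift_quot (a *: b) = a *: lift_quot b.
Proof. by rewrite /lift_quot quot_projZ -PhiZ. Qed.

Lemma lift_quot_relator a : X a -> lift_quot a = 0.
Proof.
move=> Xa; rewrite -(raddf0 lift_quot) /lift_quot; congr (Phi _).
by apply/quot_projP; rewrite subr0; apply: ideal_gen_relator.
Qed.

(** The commutator is a separate variable [e], so that in [sra] it can be the image of a commutator
    formed inside the tensor algebra. *)
Lemma lift_quot_commutator (I : finType) (P : pred I) (f : I -> K)
    (s : I -> A) w a b e :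
  e = a * b - b * a -> X (e - w%:A - \sum_(i | P i) f i *: s i) ->
  lift_quot a * lift_quot b - lift_quot b * lift_quot a
  = w%:M + \sum_(i | P i) f i *: lift_quot (s i).
Proof.
move=> -> /lift_quot_relator; rewrite !raddfB raddf_sum /= !lift_quotM lift_quotZ.
rewrite lift_quot1 scalemx1 -addrA -opprD => /eqP; rewrite subr_eq0 => /eqP ->.
by congr (_ + _); apply: eq_bigr => i _; rewrite lift_quotZ.
Qed.

End QuotientMorphism.

(** * Representations of the symplectic reflection algebra *)

Section SmashProduct.

Variables (K : comNzRingType) (G : finGroupType) (A : lalgType K).
Variable to : alg_action G A.
Implicit Types (a b : A) (g h : G).

Lemma smash_grpM g h : smash_grp to (g * h)%g = smash_grp to g * smash_grp to h.
Proof. by rewrite smash_termM mul1r rmorph1. Qed.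

Lemma smash_algB a b : smash_alg to (a - b) = smash_alg to a - smash_alg to b.
Proof.
by apply/ffunP => g; rewrite !ffunE; case: eqP => _; rewrite ?subr0.
Qed.

Lemma smash_algM a b : smash_alg to (a * b) = smash_alg to a * smash_alg to b.
Proof. by rewrite smash_termM alg_act1 mulg1. Qed.

Lemma smash_alg_commutator a b : smash_alg to (a * b - b * a)
  = smash_alg to a * smash_alg to b - smash_alg to b * smash_alg to a.
Proof. by rewrite smash_algB !smash_algM. Qed.

Lemma smash_grp_alg g a :
  smash_grp to g * smash_alg to a = smash_alg to (to g a) * smash_grp to g.
Proof. by rewrite !smash_termM mul1r rmorph1 mulr1 mul1g mulg1. Qed.

End SmashProduct.

Lemma tens_vecB (K : fieldType) (N : nat) (u v : 'M[K]_(2, N)) :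
  tens_vec (u - v) = tens_vec u - tens_vec v.
Proof. exact: (raddfB (tens_vec (K := K) (N := N))). Qed.

(** A module given on generators: the operators [rho] of the group and [Q] of the vectors, with the
    defining relations between them. *)
Record sra_action (K : fieldType) (gT : finGroupType) (N d : nat)
    (rL : mx_representation K [set: gT] 2) (k : K) (c : gT -> K)
    (rho : wreath gT N -> 'M[K]_d) (Q : 'M[K]_(2, N) -> 'M[K]_d) : Prop := {
  sra_grp1 : rho 1%g = 1;
  sra_grpM : {morph rho : g h / (g * h)%g >-> g * h};
  sra_vecB : {morph Q : u v / u - v};
  sra_grp_vec : forall g v, rho g * Q v = Q (wreath_act rL g v) * rho g;
  sra_relation : forall u v, Q u * Q v - Q v * Q u = (omegaV u v)%:M +
    \sum_(s : wreath gT N | symplectic_reflection rL s)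
       (refl_value k c s * omega_s rL s u v) *: rho s
}.

Lemma sra_actionP (K : fieldType) (gT : finGroupType) (N d : nat)
    (rL : mx_representation K [set: gT] 2) (k : K) (c : gT -> K)
    (Phi : {rmorphism sra N rL k c -> 'M[K]_d}) : scalable Phi ->
  sra_action rL k c (fun g => Phi (sra_grp rL k c g))
    (fun v => Phi (sra_vec rL k c v)).
Proof.
move=> PhiZ.
pose lift := lift_quot Phi.
split.
- exact: (lift_quot1 Phi).
- move=> g h.
  suff: lift (smash_grp (tens_action N rL) (g * h)%g)
        = lift (smash_grp _ g) * lift (smash_grp _ h) by [].
  by rewrite smash_grpM; apply: lift_quotM.
- move=> u v.
  suff: lift (smash_alg (tens_action N rL) (tens_vec (u - v)))
        = lift (smash_alg _ (tens_vec u)) - lift (smash_alg _ (tens_vec v)) by [].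
  by rewrite tens_vecB smash_algB; apply: lift_quotB.
- move=> g v.
  suff: lift (smash_grp (tens_action N rL) g) * lift (smash_alg _ (tens_vec v))
        = lift (smash_alg _ (tens_vec (wreath_act rL g v)))
          * lift (smash_grp _ g) by [].
  have eq_gv : smash_grp (tens_action N rL) g * smash_alg _ (tens_vec v)
      = smash_alg _ (tens_vec (wreath_act rL g v)) * smash_grp _ g.
    apply: etrans (smash_grp_alg _ _ _) _; congr (smash_alg _ _ * _).
    exact: tens_act_vec.
  exact: etrans (esym (lift_quotM _ _ _))
    (etrans (congr1 lift eq_gv) (lift_quotM _ _ _)).
- move=> u v.
  apply: (lift_quot_commutator PhiZ (smash_alg_commutator _ _ _)).
  by exists u, v.
Qed.

(** * Irreducible [S_N]-modules that extend to the algebra *)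

Section ExtendedModule.

Variables (K : numClosedFieldType) (gT : finGroupType) (N d : nat).
Variables (rL : mx_representation K [set: gT] 2) (k : K) (c : gT -> K).
Hypothesis rL_faithful : mx_faithful rL.
Hypothesis rL_SL2 : forall x, \det (rL x) = 1.
Variable rW : mx_representation K [set: 'S_N] d.
Hypothesis rW_irr : mx_irreducible rW.
Variables (rho : wreath gT N -> 'M[K]_d) (Q : 'M[K]_(2, N) -> 'M[K]_d).
Hypothesis rhoQ : sra_action rL k c rho Q.
Hypothesis rho_perm : forall s, rho (wreath_perm gT s) = rW s.

Implicit Types (i j : 'I_N) (x : gT) (s : wreath gT N).

Let rho_scalar := rho_base_scalar rW_irr (sra_grp1 rhoQ) (sra_grpM rhoQ) rho_perm.

Lemma wreath_act_base i x y :
  wreath_act rL (wreath_base i x) (embed i y) = embed i (rL x *m y).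
Proof.
apply: col_eqP => m; rewrite col_wreath_act !ffunE perm1 !col_embed.
by case: eqP => _; rewrite ?mulmx0.
Qed.

(** Since [x_i] acts by a nonzero scalar, [Q] takes the same value at [w] and [x w]; as [1 - x] is
    invertible on [L], every vector of the summand is some [w - x w]. *)
Lemma sra_vec_embed0 (x : gT) i y : x != 1%g -> Q (embed i y) = 0.
Proof.
move=> x1; have unit_x := unitmx_1_sub_SL2 rL_faithful (rL_SL2 x) x1.
pose w := invmx (1%:M - rL x) *m y.
have <- : embed i w - embed i (rL x *m w) = embed i y.
  by rewrite -linearB -{1}[w]mul1mx -mulmxBl mulKVmx.
have [a nz_a rho_x] := rho_scalar i x.
have: a%:M *m Q (embed i w) = Q (embed i (rL x *m w)) *m a%:M.
  by rewrite -rho_x -wreath_act_base; apply: sra_grp_vec rhoQ _ _.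
rewrite mul_scalar_mx mul_mx_scalar => /(scalerI nz_a) eqQ.
by rewrite (sra_vecB rhoQ) eqQ subrr.
Qed.

Lemma rho_refl_S i j x : rho (refl_S i j x) = rW (tperm i j).
Proof.
rewrite /refl_S !(sra_grpM rhoQ) rho_perm.
rewrite (rho_base_eq rW_irr (sra_grp1 rhoQ) (sra_grpM rhoQ) rho_perm i j).
by rewrite -mulrA -(sra_grpM rhoQ) mulgV (sra_grp1 rhoQ) mulr1.
Qed.

Definition is_refl_S (s : wreath gT N) :=
  [exists i, exists j, exists x, (i != j) && (s == refl_S i j x)].

Lemma is_refl_SP s :
  reflect (exists i j x, i != j /\ s = refl_S i j x) (is_refl_S s).
Proof.
apply: (iffP existsP) => [[i /existsP[j /existsP[x /andP[ne_ij /eqP->]]]]|].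
  by exists i, j, x.
move=> [i [j [x [ne_ij ->]]]]; exists i; apply/existsP; exists j.
by apply/existsP; exists x; rewrite ne_ij eqxx.
Qed.

Lemma omega_s_fixed s u v : is_refl_S s ->
  wreath_act rL s u = u -> wreath_act rL s v = v -> omega_s rL s u v = 0.
Proof.
move=> /is_refl_SP[i [j [x [ne_ij ->]]]] fix_u fix_v.
rewrite omega_s_involution; last exact: wreath_act_refl_SK.
rewrite fix_u fix_v !subrr scaler0 /omegaV big1 // => m _.
by rewrite linear0 -(scale0r 0) omegaLZ expr0n mul0r.
Qed.

(** [refl_value] is 0 on elements of neither type. *)
Lemma refl_value_not_S s :
  ~~ is_refl_S s -> refl_value k c s != 0 ->
  exists i x, x != 1%g /\ s = wreath_base i x.
Proof.
rewrite /is_refl_S /refl_value => /negPf ->.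
case: pickP => [[i x] /andP[x1 /eqP ->] _|_ /eqP //].
by exists i, x.
Qed.

(** Only the reflections moving [i] contribute. For each [j != i] there are [#|gT|] of them, all
    acting as [s_ij], with form value 1/2. *)
Lemma sum_refl_S i :
  let u := embed i (delta_mx 0 0) in let v := embed i (delta_mx 1 0) in
  \sum_(s | symplectic_reflection rL s && is_refl_S s)
     (refl_value k c s * omega_s rL s u v) *: rho s
  = (k * 2^-1 *+ #|gT|) *: \sum_(j | j != i) rW (tperm i j).
Proof.
move=> u v.
rewrite (bigID (fun s : wreath gT N => s.1 i == i)) /= big1 ?add0r; last first.
  move=> s /andP[/andP[_ sS] /eqP fix_i].
  have fix_embed y : wreath_act rL s (embed i y) = embed i y.
    move/is_refl_SP: sS fix_i => [a [b [x [ne_ab ->]]]]; rewrite refl_S1 => fix_i.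
    have ne_ai : a != i.
      by apply: contraNneq ne_ab => ai; move: fix_i; rewrite -ai tpermL => ->.
    have ne_bi : b != i.
      by apply: contraNneq ne_ab => bi; move: fix_i; rewrite -bi tpermR => ->.
    have [Ea Eb Em] := wreath_act_refl_S rL x (embed i y) ne_ab.
    apply: col_eqP => m; have [->|ne_ma] := eqVneq m a.
      by rewrite Ea !col_embed (negPf ne_ai) (negPf ne_bi) mulmx0.
    have [->|ne_mb] := eqVneq m b; last by rewrite Em.
    by rewrite Eb !col_embed (negPf ne_ai) (negPf ne_bi) mulmx0.
  by rewrite (omega_s_fixed sS (fix_embed _) (fix_embed _)) mulr0 scale0r.
(* A reflection [s] moving [i] is uniquely [refl_S i j x]: [j] is the image of [i], and [x] is the
   component at [j]. *)
pose h (p : 'I_N * gT) := refl_S i p.1 p.2.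
pose h' (s : wreath gT N) := (s.1 i, s.2 (s.1 i)).
have refl_S_i s : is_refl_S s -> s.1 i != i -> h (h' s) = s.
  move=> /is_refl_SP[a [b [x [ne_ab ->]]]]; rewrite refl_S1 => move_i.
  rewrite /h' refl_S1 /h [(_, _).1]/= [(_, _).2]/=.
  have ab_i : (i == a) || (i == b).
    apply: contraR move_i; rewrite negb_or ![i == _]eq_sym => /andP[ne_ai ne_bi].
    by rewrite tpermD.
  have [ia|ne_ia] := eqVneq i a; first by rewrite ia tpermL refl_S2 // eqxx.
  rewrite (negPf ne_ia) /= in ab_i; rewrite (eqP ab_i) tpermR.
  by rewrite refl_S2 // (negPf ne_ab) eqxx refl_S_sym.
rewrite (reindex_onto h h') => [|s /andP[/andP[_ sS] ne_i]]; last exact: refl_S_i.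
have condE p : symplectic_reflection rL (h p) && is_refl_S (h p) && ((h p).1 i != i)
    && (h' (h p) == p) = (p.1 != i).
  rewrite /h /h' refl_S1 tpermL.
  have [->|ne_pi] := eqVneq p.1 i; first by rewrite andbF.
  rewrite eq_sym in ne_pi; rewrite symplectic_reflection_refl_S // refl_S2 // eqxx.
  have -> : is_refl_S (refl_S i p.1 p.2) by apply/is_refl_SP; exists i, p.1, p.2.
  by rewrite -surjective_pairing eqxx.
rewrite (eq_bigl _ _ condE).
have termE p : p.1 != i ->
    (refl_value k c (h p) * omega_s rL (h p) u v) *: rho (h p)
    = (k * 2^-1) *: rW (tperm i p.1).
  rewrite eq_sym => ne_ip; rewrite rho_refl_S omega_s_refl_S // /refl_value.
  by rewrite ifT //; apply/is_refl_SP; exists i, p.1, p.2.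
rewrite (eq_bigr _ termE) scaler_sumr.
rewrite (eq_bigl (fun p : 'I_N * gT => (p.1 != i) && true)) => [|p]; last first.
  by rewrite andbT.
rewrite -(pair_big (fun j => j != i) xpredT
            (fun j _ => (k * 2^-1) *: rW (tperm i j))) /=.
by apply: eq_bigr => j _; rewrite sumr_const scalerMnl.
Qed.

Lemma sum_not_refl_S u v : exists b,
  \sum_(s | symplectic_reflection rL s && ~~ is_refl_S s)
     (refl_value k c s * omega_s rL s u v) *: rho s = b%:M.
Proof.
elim/big_ind: _ => [|A B [a ->] [b ->]|s /andP[_ nS]].
- by exists 0; rewrite raddf0.
- by exists (a + b); rewrite raddfD.
have [->|nz_s] := eqVneq (refl_value k c s) 0.
  by exists 0; rewrite mul0r scale0r raddf0.
have [i [x [_ ->]]] := refl_value_not_S nS nz_s.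
have [a _ ->] := rho_scalar i x.
set f := refl_value _ _ _ * _.
by exists (f * a); rewrite scale_scalar_mx.
Qed.

(** Both vectors act by 0, so the relation reads [0 = a + b + C J], with [J] the Jucys-Murphy sum
    and [C = k #|gT| / 2] nonzero. *)
Lemma jucys_murphy_scalar_of_base (x0 : gT) i : k != 0 -> x0 != 1%g ->
  exists t, \sum_(j | j != i) rW (tperm i j) = t%:M.
Proof.
move=> nz_k x01.
have := sra_relation rhoQ (embed i (delta_mx 0 0)) (embed i (delta_mx 1 0)).
rewrite !(sra_vec_embed0 _ _ x01) mul0r subrr (bigID is_refl_S) /= sum_refl_S.
have [b ->] := sum_not_refl_S (embed i (delta_mx 0 0)) (embed i (delta_mx 1 0)).
set a := omegaV _ _; set C := k * _ *+ _ => rel.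
have nz_C : C != 0.
  by rewrite mulrn_eq0 negb_or mulf_neq0 ?invr_neq0 ?pnatr_eq0 // andbT (cardD1 x0).
exists (C^-1 * - (a + b)); apply: (scalerI nz_C).
rewrite -[in RHS]scale_scalar_mx scalerA mulfV // scale1r.
by apply/eqP; rewrite raddfN raddfD /= -addr_eq0 addrCA -rel.
Qed.

(* If Gamma is trivial, the sums of the two halves of the basis of [V] generate
   a Weyl algebra, and a Weyl algebra has no finite dimensional module. *)
Lemma base_group_nontrivial (i0 : 'I_N) : exists x0 : gT, x0 != 1%g.
Proof.
case: (pickP (fun x : gT => x != 1%g)) => [x0 x01|triv]; first by exists x0.
have gT1 (x : gT) : x = 1%g by apply/eqP/negPn; rewrite triv.
(* These diagonal vectors are fixed by the whole group, so no reflection contributes to their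
   commutator, which is the scalar [N]. *)
pose u (a : 'I_2) : 'M[K]_(2, N) := \sum_i embed i (delta_mx a 0).
have col_u a m : col m (u a) = delta_mx a 0.
  rewrite linear_sum (bigD1 m) //= col_embed eqxx big1 ?addr0 // => i ne_im.
  by rewrite col_embed eq_sym (negPf ne_im).
have fix_u a s : wreath_act rL s (u a) = u a.
  apply: col_eqP => m.
  by rewrite col_wreath_act !col_u (gT1 (s.2 m)) repr_mx1 mul1mx.
have omega_u : omegaV (u 0) (u 1) = N%:R.
  rewrite /omegaV; under eq_bigr => m _ do rewrite !col_u omegaL_basis.
  by rewrite sumr_const card_ord.
have := sra_relation rhoQ (u 0) (u 1).
rewrite big1 => [|s _]; last first.
  have [sS|nS] := boolP (is_refl_S s).
    by rewrite (omega_s_fixed sS (fix_u _ _) (fix_u _ _)) mulr0 scale0r.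
  have [->|nz_s] := eqVneq (refl_value k c s) 0; first by rewrite mul0r scale0r.
  by have [i [x [x1 _]]] := refl_value_not_S nS nz_s; rewrite (gT1 x) eqxx in x1.
(* A commutator has trace 0, whereas the scalar [N] has trace [N d], which is nonzero. *)
rewrite addr0 omega_u => /(congr1 mxtrace); rewrite linearB /=.
rewrite -[Q (u 0) * _]/(Q (u 0) *m _) mxtrace_mulC subrr mxtrace_scalar => /esym/eqP.
rewrite mulrn_eq0 pnatr_eq0.
have [_ nz1 _] := rW_irr.
case: (d) nz1 => [|d' _] /=; first by move=> /eqP[]; apply/matrixP; case.
by rewrite -[N == 0%N]negbK -lt0n (leq_ltn_trans _ (ltn_ord i0)).
Qed.

End ExtendedModule.

Theorem proposition3p2 (R : realType) (N : nat) (hN : (2 <= N)%N)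
    (gT : finGroupType) (rL : mx_representation R[i] [set: gT]%G 2)
    (rL_faithful : mx_faithful rL)
    (rL_SL2 : forall x : gT, \det (rL x) = 1)
    (d : nat) (rW : mx_representation R[i] [set: 'S_N]%G d)
    (rW_irr : mx_irreducible rW) (lam : seq nat)
    (rW_lam : has_young_diagram rW lam) :
  (exists (k : R[i]) (c : gT -> R[i]),
      [/\ forall x y : gT, x != 1%g -> c (x ^ y)%g = c x,
          k != 0 & extends_to_sra rL k c rW]) ->
  rectangle lam.
Proof.
move=> [k [c [_ nz_k [Phi [PhiZ Phi_rW]]]]].
have rhoQ := sra_actionP PhiZ.
(* [ltnW hN] is read as [0 < N], so [i] is the first index. *)
pose i := Ordinal (ltnW hN).
have [x0 x01] := base_group_nontrivial rW_irr rhoQ i.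
have [t JM_t] := jucys_murphy_scalar_of_base rL_faithful rL_SL2 rW_irr rhoQ
  Phi_rW i nz_k x01.
exact: jucys_murphy_scalar_rectangle rW_lam JM_t.
Qed.
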